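(* Let $X$ be a quasi-Banach function lattice over $(\mathcal P,\mu)$. Suppose that for every bounded (measurable) set $B\subset\mathcal P$ we have $\chi_B\in X$ and $\chi_B$ has absolutely continuous quasi-norm in $X$. If $u:\mathcal P\to[-\infty,\infty]$ is measurable, then $$\|u\|_X=\inf\{\|v\|_X:\ v\ge|u| \text{ on }\mathcal P \text{ and } v\in \mathrm{lsc}(\mathcal P)\}.$$
   Context: Setting. $\mathcal P=(\mathcal P,\mathrm d,\mu)$ is a metric space with a $\sigma$-finite Borel regular measure $\mu$ (all Borel sets are $\mu$-measurable, and every $\mu$-measurable set $A$ is contained in a Borel set $D$ with $\mu(D)=\mu(A)$) such that every ball has finite positive measure. $\mathcal M(\mathcal P,\mu)$ is the set of all extended real-valued $\mu$-measurable functions on $\mathcal P$ (defined everywhere). Quasi-Banach function lattice: a linear space $X=\{u\in\mathcal M(\mathcal P,\mu):\|u\|_X<\infty\}$ given by a functional $\|\cdot\|_X:\mathcal M(\mathcal P,\mu)\to[0,\infty]$ such that: $\|u\|_X=0$ iff $u=0$ a.e.; $\|au\|_X=|a|\,\|u\|_X$ for $a\in\mathbb R$; there is a constant $c_\triangle\ge1$ (modulus of concavity) with $\|u+v\|_X\le c_\triangle(\|u\|_X+\|v\|_X)$; if $|u|\le|v|$ a.e. then $\|u\|_X\le\|v\|_X$; and (Riesz--Fischer) if $u_n\ge0$ a.e. for all $n$ then $\|\sum_{n=1}^\infty u_n\|_X\le\sum_{n=1}^\infty c_\triangle^n\|u_n\|_X$. The quasi-norm is also assumed continuous: $\|u_n-u\|_X\to0$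 implies $\|u_n\|_X\to\|u\|_X$. A function $u\in X$ has absolutely continuous quasi-norm in $X$ if $\|u\chi_{E_n}\|_X\to0$ as $n\to\infty$ whenever $\{E_n\}_{n=1}^\infty$ is a decreasing sequence of measurable sets with $\mu(\bigcap_n E_n)=0$. $\mathrm{lsc}(\mathcal P)$ denotes the (extended real-valued) lower semicontinuous functions on $\mathcal P$. *)

(* Defs.v *)
From HB Require Import structures.
From mathcomp Require Import all_boot all_order all_algebra.
From mathcomp Require Import all_classical all_reals all_analysis measurable_realfun.

Set Implicit Arguments.
Unset Strict Implicit.
Unset Printing Implicit Defensive.

Import Order.TTheory GRing.Theory Num.Theory.
Import numFieldNormedType.Exports.

Local Open Scope classical_set_scope.
Local Open Scope ring_scope.

(* A metric space with a sigma-algebra; the compatibility of the two structures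
   is part of [borel_regular] below. *)
#[short(type="measurableMetricType")]
HB.structure Definition MeasurableMetric (d : measure_display)
  (R : numDomainType) := {P of Measurable d P & Metric R P}.

Definition metric_bounded (R : numDomainType) (P : metricType R) (B : set P) :=
  exists M : R, forall x y, B x -> B y -> mdist x y <= M.

Definition borel_set (T : topologicalType) : set (set T) := <<s @open T >>.

Definition borel_regular (d : measure_display) (R : realType)
    (P : measurableMetricType d R) (mu : {measure set P -> \bar R}) : Prop :=
  (forall A : set P, borel_set A -> measurable A) /\
  (forall A : set P, measurable A ->
     exists D : set P, [/\ borel_set D, A `<=` D & mu D = mu A]).

Definition balls_finite_positive (d : measure_display) (R : realType)
    (P : measurableMetricType d R) (mu : {measure set P -> \bar R}) : Prop :=
  forall (x : P) (r : R), 0 < r -> (0 < mu (ball x r) < +oo)%E.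

Local Open Scope ereal_scope.

(* [qnorm X] is only meaningful on measurable functions.
   On \bar R, 0 * +oo = 0 and +oo - oo = -oo.  The value of u x + v x where it
   is an indeterminate form is irrelevant in [qnorm_triangle], because
   |u + v| <= |u| + |v| there under any convention, and in [qnorm_continuous],
   because functions of finite quasi-norm are finite a.e.
   In [qnorm_riesz_fischer] the sequence is indexed from 0, whence c ^+ n.+1;
   the pointwise sum is a genuine sum of nonnegative terms a.e. only. *)
Record quasiBanachLattice (d : measure_display) (R : realType)
    (P : measurableMetricType d R) (mu : {measure set P -> \bar R}) :=
  QuasiBanachLattice {
  qnorm : (P -> \bar R) -> \bar R ;
  concavity_modulus : R ;
  concavity_modulus_ge1 : (1 <= concavity_modulus)%R ;
  qnorm_ge0 : forall u : P -> \bar R, measurable_fun setT u -> 0 <= qnorm u ;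
  qnorm_eq0 : forall u : P -> \bar R, measurable_fun setT u ->
    (qnorm u = 0 <-> {ae mu, forall x, u x = 0}) ;
  qnormZ : forall (a : R) (u : P -> \bar R), measurable_fun setT u ->
    qnorm (fun x => a%:E * u x) = `|a|%:E * qnorm u ;
  qnorm_triangle : forall u v : P -> \bar R,
    measurable_fun setT u -> measurable_fun setT v ->
    qnorm (fun x => u x + v x) <= concavity_modulus%:E * (qnorm u + qnorm v) ;
  qnorm_lattice : forall u v : P -> \bar R,
    measurable_fun setT u -> measurable_fun setT v ->
    {ae mu, forall x, `|u x| <= `|v x|} -> qnorm u <= qnorm v ;
  qnorm_riesz_fischer : forall u : nat -> P -> \bar R,
    (forall n, measurable_fun setT (u n)) ->
    (forall n, {ae mu, forall x, 0 <= u n x}) ->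
    qnorm (fun x => \sum_(0 <= n <oo) u n x) <=
      \sum_(0 <= n <oo) (concavity_modulus ^+ n.+1)%:E * qnorm (u n) ;
  qnorm_continuous : forall (u_ : nat -> P -> \bar R) (u : P -> \bar R),
    (forall n, measurable_fun setT (u_ n) /\ qnorm (u_ n) < +oo) ->
    measurable_fun setT u /\ qnorm u < +oo ->
    qnorm (fun x => u_ n x - u x) @[n --> \oo] --> 0 ->
    qnorm (u_ n) @[n --> \oo] --> qnorm u
}.

Definition lattice_space (d : measure_display) (R : realType)
    (P : measurableMetricType d R) (mu : {measure set P -> \bar R})
    (X : quasiBanachLattice mu) : set (P -> \bar R) :=
  [set u | measurable_fun setT u /\ qnorm X u < +oo].

Definition absolutely_continuous_qnorm (d : measure_display) (R : realType)
    (P : measurableMetricType d R) (mu : {measure set P -> \bar R})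
    (X : quasiBanachLattice mu) (u : P -> \bar R) : Prop :=
  forall E : nat -> set P,
    (forall n, measurable (E n)) ->
    nonincreasing_seq E ->
    mu (\bigcap_n E n) = 0 ->
    qnorm X (fun x => u x * (\1_(E n) x)%:E) @[n --> \oo] --> 0.

(* Main.v *)
Require Import Defs.
From mathcomp Require Import all_boot all_order all_algebra.
From mathcomp Require Import all_classical all_reals all_analysis measurable_realfun.
Import Order.TTheory GRing.Theory Num.Theory.
Import numFieldNormedType.Exports.

Local Open Scope classical_set_scope.
Local Open Scope ring_scope.
Local Open Scope ereal_scope.

(* The set function [A |-> ||1_(B `&` A)||] is continuous from above along
   decreasing sequences for bounded [B], and Riesz-Fischer replaces countable
   subadditivity, so the usual sigma-algebra argument shows that every Borel set
   is squeezed between a closed and an open set with a small difference in this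
   sense.  Hence a measurable [A] has open supersets [U] with [||1_(U `\` A)||]
   arbitrarily small.  Writing [|u| = \sum_n a_n 1_(A_n)] and replacing each
   [A_n] by an open [U_n] gives a lower semicontinuous [v = |u| + w] with [||w||]
   small, and the continuity of the quasi-norm concludes. *)

(** * Expansion of nonnegative functions along the harmonic series *)

Section greedy_harmonic.
Context {T : Type} {R : realType} (u : T -> \bar R).

(** Greedy expansion: the term 1/(m+1) is taken at a point exactly when the new sum does not exceed
    [u] there. The terms tend to 0 and have a divergent sum, so this reaches every value in
    [0, +oo], infinity included, with coefficients that do not depend on the point. *)
Fixpoint greedy_sum (n : nat) (x : T) : R :=
  if n is m.+1 then
    (greedy_sum m x +
     harmonic m * \1_[set y | (((greedy_sum m y + harmonic m)%R)%:E <= u y)%E] x)%R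
  else 0%R.

Definition greedy_set (n : nat) : set T :=
  [set y | ((greedy_sum n y + harmonic n)%R)%:E <= u y].

Lemma greedy_sumE (n : nat) (x : T) :
  (greedy_sum n x)%:E =
  \sum_(0 <= i < n) (harmonic i)%:E * (\1_(greedy_set i) x)%:E.
Proof.
elim: n => [|n IHn]; first by rewrite big_nil.
by rewrite big_nat_recr//= -IHn EFinD EFinM.
Qed.

Lemma greedy_sum_le (n : nat) (x : T) :
  0 <= u x -> (greedy_sum n x)%:E <= u x.
Proof.
move=> ux0; elim: n => [//|n IHn] /=.
rewrite indicE; have [|] := boolP (x \in _); last by rewrite mulr0 addr0.
by rewrite inE/= mulr1.
Qed.

(* If the greedy sum stayed a fixed amount below [u x], then from some index on
   every harmonic term would be selected, and the harmonic series would converge. *)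
Lemma greedy_sum_exhausts (x : T) : 0 <= u x ->
  u x = \sum_(0 <= n <oo) (harmonic n)%:E * (\1_(greedy_set n) x)%:E.
Proof.
move=> ux0; set s := \sum_(0 <= n <oo) _.
have t0 n : 0 <= (harmonic n)%:E * (\1_(greedy_set n) x)%:E :> \bar R.
  by rewrite mule_ge0// lee_fin// harmonic_ge0.
have s0 : 0 <= s by apply: nneseries_ge0 => n _ _; exact: t0.
have sn n : (greedy_sum n x)%:E <= s.
  by rewrite greedy_sumE; apply: nneseries_lim_ge => k _ _; exact: t0.
have su : s <= u x.
  apply: lime_le; first by apply: is_cvg_nneseries => n _ _; exact: t0.
  by apply: nearW => n /=; rewrite -greedy_sumE; exact: greedy_sum_le.
apply/eqP; rewrite eq_le su andbT leNgt; apply/negP => slt.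
have [l sl] : exists l, s = l%:E.
  exists (fine s); rewrite fineK// ge0_fin_numE//.
  by rewrite (lt_le_trans slt)// leey.
rewrite sl in slt sn.
have [e e0 leu] : exists2 e : R, (0 < e)%R & ((l + e)%R)%:E <= u x.
  case: (u x) slt => [r| |]//=.
  - rewrite lte_fin => lr; exists (r - l)%R; first by rewrite subr_gt0.
    by rewrite lee_fin addrC subrK.
  - by exists 1%R => //; rewrite leey.
have [N _ hN] : \forall n \near \oo, (@harmonic R n <= e)%R.
  have := @cvg_harmonic R => /cvgrPdist_le /(_ e e0); apply: filterS => n.
  by rewrite sub0r normrN ger0_norm// harmonic_ge0.
have step n : (greedy_sum (n + N) x =
    greedy_sum N x + \sum_(N <= k < n + N) harmonic k)%R.
  elim: n => [|n IHn]; first by rewrite add0n big_geq// addr0.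
  rewrite addSn big_nat_recr ?leq_addl//= addrA -IHn indicE mem_set ?mulr1//=.
  apply: (le_trans _ leu); rewrite lee_fin lerD//.
    by have := sn (n + N)%N; rewrite lee_fin.
  by apply: hN => /=; rewrite leq_addl.
(* The harmonic tail from [N] on is nondecreasing and bounded by [l], being a difference of two
   nonnegative greedy sums; hence it would converge. *)
apply: (@dvg_harmonic R); rewrite -(is_cvg_series_restrict N).
apply: nondecreasing_is_cvgn => [m n mn /=|].
  have [Nm|mN] := leqP N m; last first.
    rewrite big_geq; last exact: ltnW.
    by apply: sumr_ge0 => i _; exact: harmonic_ge0.
  rewrite (big_cat_nat Nm mn)/= lerDl.
  by apply: sumr_ge0 => i _; exact: harmonic_ge0.
exists l => _ [n _ <-]; rewrite /=; have [Nn|nN] := leqP N n; last first.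
  rewrite big_geq ?(ltnW nN)// -lee_fin -sl//.
have := sn n; rewrite -{1}(subnK Nn) step subnK// lee_fin; apply: le_trans.
rewrite lerDr -lee_fin greedy_sumE.
by apply: sume_ge0 => i _; exact: t0.
Qed.

End greedy_harmonic.

Lemma measurable_greedy_set (d : measure_display) (T : measurableType d)
    (R : realType) (u : T -> \bar R) (n : nat) :
  measurable_fun setT u -> measurable (greedy_set u n).
Proof.
move=> mu.
have mset k : measurable_fun setT (greedy_sum u k) ->
    measurable (greedy_set u k).
  move=> ms; rewrite -[X in measurable X]setTI; apply: measurable_lee => //.
  by apply/measurable_EFinP; apply: measurable_funD => //; exact: measurable_cst.
apply: (mset n); elim: n => [|n IHn] /=; first exact: measurable_cst.
apply: measurable_funD => //; apply: measurable_funM; first exact: measurable_cst.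
by apply: measurable_indic; exact: mset.
Qed.

(** The series is the supremum of its partial sums. One of them already exceeds [r] at [x], and it
    does not drop near [x], since each open [U n] containing [x] contains a neighbourhood of [x]. *)
Lemma lower_semicontinuous_nneseries_indic (T : topologicalType) (R : realType)
    (a : nat -> R) (U : nat -> set T) :
  (forall n, (0 <= a n)%R) -> (forall n, open (U n)) ->
  lower_semicontinuous
    (fun x => \sum_(0 <= n <oo) (a n)%:E * (\1_(U n) x)%:E).
Proof.
move=> a0 oU x r rv.
have t0 n y : 0 <= (a n)%:E * (\1_(U n) y)%:E :> \bar R.
  by rewrite mule_ge0// lee_fin.
have [N rN] : exists N, r%:E < \sum_(0 <= n < N) (a n)%:E * (\1_(U n) x)%:E.
  apply: contrapT => /forallNP hN; move: rv; apply/negP; rewrite -leNgt.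
  apply: lime_le; first by apply: is_cvg_nneseries => n _ _; exact: t0.
  by apply: nearW => n /=; rewrite leNgt; apply/negP; exact: hN.
suff: \forall y \near x, \sum_(0 <= n < N) (a n)%:E * (\1_(U n) x)%:E <=
    \sum_(0 <= n < N) (a n)%:E * (\1_(U n) y)%:E.
  move=> V; eexists; first exact: V.
  move=> y /= xy; apply: (lt_le_trans rN); apply: (le_trans xy).
  by apply: nneseries_lim_ge => k _ _; exact: t0.
elim: N {rN} => [|N IHN]; first by apply: nearW => y; rewrite !big_nil.
have xU : \forall y \near x, (\1_(U N) x <= \1_(U N) y :> R)%R.
  have [xU|xU] := pselect (U N x); last first.
    by apply: nearW => y; rewrite [leLHS]indicE memNset.
  have : nbhs x (U N) by exact: open_nbhs_nbhs.
  by apply: filterS => y yU; rewrite !indicE !mem_set.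
apply: filterS2 IHN xU => y IHy xUy; rewrite !big_nat_recr//= leeD//.
by rewrite lee_wpmul2l ?lee_fin.
Qed.

(** * Quasi-norms of indicators and Riesz-Fischer estimates *)

Section qnorm_indicator.
Context {d : measure_display} {R : realType} {P : measurableMetricType d R}
  {mu : {measure set P -> \bar R}} (X : quasiBanachLattice mu).

Definition qnorm_indic (A : set P) : \bar R := qnorm X (fun x => (\1_A x)%:E).

Lemma measurable_EFin_indic (A : set P) :
  measurable A -> measurable_fun setT (fun x => (\1_A x)%:E : \bar R).
Proof. by move=> mA; apply/measurable_EFinP; exact: measurable_indic. Qed.

(** The power of the modulus cancels the weight in the Riesz-Fischer inequality; what remains, e /
    2^(n+1), sums to [e]. *)
Definition summable_error (e : R) (n : nat) : R :=
  (e / (2 ^ n.+1)%:R / concavity_modulus X ^+ n.+1)%R.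

Let c_gt0 : (0 < concavity_modulus X)%R.
Proof. by rewrite (lt_le_trans _ (concavity_modulus_ge1 X)). Qed.

Lemma summable_error_gt0 (e : R) (n : nat) : (0 < e)%R ->
  (0 < summable_error e n)%R.
Proof. by move=> e0; rewrite !divr_gt0// ?exprn_gt0// ltr0n expn_gt0. Qed.

Lemma qnorm_nneseries_le (e : R) (f : nat -> P -> \bar R) : (0 <= e)%R ->
  (forall n, measurable_fun setT (f n)) -> (forall n x, 0 <= f n x) ->
  (forall n, qnorm X (f n) <= (summable_error e n)%:E) ->
  qnorm X (fun x => \sum_(0 <= n <oo) f n x) <= e%:E.
Proof.
move=> e0 mf f0 fe.
apply: le_trans (qnorm_riesz_fischer X mf _) _; first by move=> n; exact: aeW.
apply: le_trans (epsilon_trick0 xpredT e0).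
apply: lee_nneseries => n _.
  by move=> _; rewrite mule_ge0 ?qnorm_ge0// lee_fin exprn_ge0// ltW.
have cn0 : (0 < concavity_modulus X ^+ n.+1)%R by rewrite exprn_gt0.
apply: (@le_trans _ _ ((concavity_modulus X ^+ n.+1)%:E * (summable_error e n)%:E)).
  by rewrite lee_wpmul2l// lee_fin ltW.
by rewrite -EFinM lee_fin mulrC divfK// gt_eqF.
Qed.

(** The lattice property compares functions almost everywhere only, so the part of [A] outside [B]
    costs nothing. This is what later permits passing to a Borel hull. *)
Lemma qnorm_indic_le (A B : set P) : measurable A -> measurable B ->
  mu (A `\` B) = 0 -> qnorm_indic A <= qnorm_indic B.
Proof.
move=> mA mB AB0; apply: qnorm_lattice; try exact: measurable_EFin_indic.
exists (A `\` B); split => //; first exact: measurableD.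
move=> x /= /negP; rewrite -ltNge lte_fin.
rewrite !indicE; case: (boolP (x \in A)) => [|_]; case: (boolP (x \in B)) => [|].
all: rewrite ?inE ?notin_setE// ?normr0 ?normr1 ?ltxx// ?ltr10//.
Qed.

Lemma qnorm_indicS (A B : set P) : measurable A -> measurable B ->
  A `<=` B -> qnorm_indic A <= qnorm_indic B.
Proof.
move=> mA mB AB; apply: qnorm_indic_le => //.
by have -> : A `\` B = set0; rewrite ?measure0// setD_eq0.
Qed.

Lemma qnorm_indic_bigcup (e : R) (A : nat -> set P) : (0 <= e)%R ->
  (forall n, measurable (A n)) ->
  (forall n, qnorm_indic (A n) <= (summable_error e n)%:E) ->
  qnorm_indic (\bigcup_n A n) <= e%:E.
Proof.
move=> e0 mA Ae.
apply: le_trans (qnorm_nneseries_le e (fun n x => (\1_(A n) x)%:E) e0 _ _ Ae).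
- apply: qnorm_lattice.
  + by apply: measurable_EFin_indic; exact: bigcup_measurable.
  + apply: ge0_emeasurable_sum => [n x _ _|n _]; first by rewrite lee_fin.
    exact: measurable_EFin_indic.
  apply: aeW => x; rewrite [leRHS]gee0_abs; last exact: nneseries_ge0.
  rewrite gee0_abs ?lee_fin// [X in X%:E <= _]indicE.
  case: (boolP (x \in _)) => [|_]; last exact: nneseries_ge0.
  rewrite inE => -[n _ Anx].
  apply: le_trans (nneseries_lim_ge n.+1 _); last by [].
  rewrite big_nat_recr//= [X in _ <= _ + X%:E]indicE mem_set//.
  by rewrite leeDr// sume_ge0.
- by move=> n; exact: measurable_EFin_indic.
- by move=> n x; rewrite lee_fin.
Qed.

(** On the set where [|u|] is infinite, [|u|] dominates every multiple n of the indicator of that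
    set. By homogeneity n times the quasi-norm of the indicator stays below the finite [qnorm X u],
    so it vanishes and the set is null. *)
Lemma qnorm_finite_ae (u : P -> \bar R) : measurable_fun setT u ->
  qnorm X u < +oo -> {ae mu, forall x, `|u x| < +oo}.
Proof.
move=> mu_ uoo.
have mA : measurable [set x | +oo <= `|u x|].
  rewrite -[X in measurable X]setTI; apply: measurable_lee => //.
  exact: measurableT_comp.
have mI := measurable_EFin_indic _ mA.
suff : qnorm_indic [set x | +oo <= `|u x|] = 0.
  move/(qnorm_eq0 X mI); apply: filterS => x.
  rewrite indicE; case: (boolP (x \in _)) => [_ [] /eqP|]; first by rewrite oner_eq0.
  by rewrite notin_setE/= => /negP; rewrite -ltNge.
have le n : n%:R%:E * qnorm_indic [set x | +oo <= `|u x|] <= qnorm X u.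
  rewrite -[X in X%:E * _]ger0_norm// -qnormZ//; apply: qnorm_lattice => //.
    by apply: emeasurable_funM => //; exact: measurable_cst.
  apply: aeW => x; rewrite -EFinM indicE; case: (boolP (x \in _)) => [|_].
    by rewrite inE/= => /(le_trans _) ->//; rewrite leey.
  by rewrite mulr0 abse0.
have q0 : 0 <= qnorm_indic [set x | +oo <= `|u x|] by exact: qnorm_ge0.
have u0 : 0 <= qnorm X u by exact: qnorm_ge0.
have [r ur] : exists r, qnorm X u = r%:E.
  by exists (fine (qnorm X u)); rewrite fineK// ge0_fin_numE.
have := le 1%N; rewrite mul1e => l1.
have [q qE] : exists q, qnorm_indic [set x | +oo <= `|u x|] = q%:E.
  exists (fine (qnorm_indic [set x | +oo <= `|u x|])).
  by rewrite fineK// ge0_fin_numE// (le_lt_trans l1).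
rewrite qE ur lee_fin in le q0 u0 *.
congr EFin; apply/eqP; rewrite eq_le q0 andbT leNgt; apply/negP => qp.
have [n rn] : exists n : nat, (r / q < n%:R)%R.
  exists (Num.bound (r / q)); apply: archi_boundP; rewrite divr_ge0//.
by have := le n; rewrite -EFinM lee_fin leNgt -ltr_pdivrMr// rn.
Qed.

End qnorm_indicator.

Lemma open_mdist_ball (R : realType) (M : metricType R) (x : M) (r : R) :
  open (ball x r).
Proof.
rewrite openE => y; rewrite ballEmdist/= => xy; apply/nbhs_ballP.
exists (r - mdist x y)%R; first by rewrite /= subr_gt0.
move=> z; rewrite !ballEmdist/= ltrBrDl.
exact: le_lt_trans (metric_triangle _ _ _).
Qed.

(** * Regularity of Borel sets for the quasi-norm inside a bounded window *)

Section regularity.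
Context {d : measure_display} {R : realType} {P : measurableMetricType d R}
  {mu : {measure set P -> \bar R}} (X : quasiBanachLattice mu).
Hypothesis mu_regular : borel_regular mu.

Lemma open_measurable_borel (U : set P) : open U -> measurable U.
Proof. by move=> oU; apply: mu_regular.1; exact: sub_sigma_algebra. Qed.

Lemma closed_measurable_borel (F : set P) : closed F -> measurable F.
Proof.
by move=> cF; rewrite -[F]setCK; apply/measurableC/open_measurable_borel/closed_openC.
Qed.

(** The approximation is two-sided, closed inside and open outside, so that the class of regular
    sets is stable under complements. *)
Definition qnorm_regular (B A : set P) : Prop :=
  forall e : R, (0 < e)%R -> exists F U, [/\ closed F, open U, F `<=` A, A `<=` U &
    qnorm_indic X (B `&` (U `\` F)) <= e%:E].

Section fixed_window.
Variable B : set P.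
Hypothesis measurable_B : measurable B.
Hypothesis abs_cont_B : absolutely_continuous_qnorm X (fun x => (\1_B x)%:E).

Lemma qnorm_indic_decreasing (e : R) (E : nat -> set P) : (0 < e)%R ->
  (forall n, measurable (E n)) -> nonincreasing_seq E -> \bigcap_n E n = set0 ->
  exists n, qnorm_indic X (B `&` E n) <= e%:E.
Proof.
move=> e0 mE dE E0.
have muE0 : mu (\bigcap_n E n) = 0 by rewrite E0 measure0.
(* Convergence in the extended reals splits into finiteness from [N] on and closeness of the real
   parts to 0 from [M] on; hence the index [maxn N M]. *)
have /fine_cvgP[[N _ fN] /cvgrPdist_le /(_ e e0)[M _ hM]] := abs_cont_B _ mE dE muE0.
exists (maxn N M); rewrite /qnorm_indic.
have -> : (fun x => (\1_(B `&` E (maxn N M)) x)%:E) =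
    (fun x => (\1_B x)%:E * (\1_(E (maxn N M)) x)%:E) :> (P -> \bar R).
  by apply/funext => x; rewrite indicI EFinM.
have := hM (maxn N M) (leq_maxr _ _); rewrite /= sub0r normrN => /(le_trans (ler_norm _)).
by rewrite -lee_fin fineK//; apply: fN; rewrite /= leq_maxl.
Qed.

(** The outer set is [U] itself. The inner sets [F n] consist of the points at distance at least
    1/(n+1) from every point outside [U]; they are closed and increase to [U], so absolute
    continuity applies to the differences. *)
Lemma qnorm_regular_open (U : set P) : open U -> qnorm_regular B U.
Proof.
move=> oU e e0.
pose F n := ~` \bigcup_(y in ~` U) ball y (@harmonic R n).
have cF n : closed (F n).
  by apply: open_closedC; apply: bigcup_open => y _; exact: open_mdist_ball.
have FU n : F n `<=` U.
  move=> x Fx; apply: contrapT => Ux; apply: Fx; exists x => //.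
  by apply: ballxx; exact: harmonic_gt0.
have F_incr m n : (m <= n)%N -> F m `<=` F n.
  move=> mn; apply: subsetC; apply: subset_bigcup => y _.
  apply: le_ball; rewrite lef_pV2 ?posrE//.
  by rewrite ler_nat ltnS.
have [n Fn] : exists n, qnorm_indic X (B `&` (U `\` F n)) <= e%:E.
  apply: qnorm_indic_decreasing => //.
  - by move=> n; apply: measurableD;
      [exact: open_measurable_borel|exact: closed_measurable_borel].
  - move=> m n mn; apply/subsetPset => x [Ux Fx]; split => //.
    by move=> Fmx; apply: Fx; exact: F_incr Fmx.
  - rewrite -subset0 => x Ix; have [Ux _] := Ix 0%N I.
    have /nbhs_ballP[r /= r0 rU] : nbhs x U by exact: open_nbhs_nbhs.
    have [n nr] : exists n, (@harmonic R n < r)%R.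
      have := @cvg_harmonic R => /cvgrPdist_lt /(_ r r0)[n _ /(_ n (leqnn _))].
      by rewrite sub0r normrN ger0_norm ?harmonic_ge0// => ?; exists n.
    have [_] := Ix n I; apply => -[y Uy /ball_sym xy].
    by apply: Uy; apply: rU; apply: le_ball xy; exact: ltW.
by exists (F n), U; split.
Qed.

Lemma qnorm_regularC (A : set P) : qnorm_regular B A -> qnorm_regular B (~` A).
Proof.
move=> rA e /rA[F [U [cF oU FA AU FU]]].
exists (~` U), (~` F); split.
- exact: open_closedC.
- exact: closed_openC.
- exact: subsetC.
- exact: subsetC.
- by rewrite setDE setCK [~` F `&` U]setIC -setDE.
Qed.

(** A countable union of closed sets need not be closed, so only the finite union [G m] is kept
    inside; the discarded part decreases to the empty set and is small by absolute continuity. *)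
Lemma qnorm_regular_bigcup (A : nat -> set P) :
  (forall n, qnorm_regular B (A n)) -> qnorm_regular B (\bigcup_n A n).
Proof.
move=> rA e e0.
(* The errors are shifted by one: index 0 is reserved for the truncation to [G m]. *)
have /choice[FU hFU] : forall n, exists p : set P * set P, [/\ closed p.1, open p.2,
    p.1 `<=` A n, A n `<=` p.2 &
    qnorm_indic X (B `&` (p.2 `\` p.1)) <= (summable_error X e n.+1)%:E].
  move=> n; have [F [U ?]] := rA n _ (summable_error_gt0 X e n.+1 e0).
  by exists (F, U).
pose F n := (FU n).1; pose U n := (FU n).2.
have cF n : closed (F n) by case: (hFU n).
have oU n : open (U n) by case: (hFU n).
pose G m := \bigcup_(i in `I_m) F i.
have cG m : closed (G m) by apply: closed_bigcup => //; exact: finite_II.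
have mF n : measurable (F n) by exact: closed_measurable_borel.
have mU n : measurable (U n) by exact: open_measurable_borel.
have mG m : measurable (G m) by exact: closed_measurable_borel.
have [m Gm] : exists m, qnorm_indic X (B `&` (\bigcup_n F n `\` G m)) <=
    (summable_error X e 0)%:E.
  apply: qnorm_indic_decreasing; first exact: summable_error_gt0.
  - by move=> m; apply: measurableD => //; exact: bigcup_measurable.
  - move=> m n mn; apply/subsetPset; apply: setDS; apply: bigcup_sub => i /= im.
    by apply: bigcup_sup => /=; exact: leq_trans mn.
  - rewrite -subset0 => x Ix; have [[i _ Fix] _] := Ix 0%N I.
    by have [_] := Ix i.+1 I; apply; exists i => /=.
pose S n := if n is k.+1 then B `&` (U k `\` F k) else B `&` (\bigcup_n F n `\` G m).
have mS n : measurable (S n).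
  case: n => [|n]; apply: measurableI => //; apply: measurableD => //.
  exact: bigcup_measurable.
exists (G m), (\bigcup_n U n); split => //; first exact: bigcup_open.
- by move=> x [i _ Fix]; exists i => //; case: (hFU i) => _ _ + _ _; apply.
- by move=> x [i _ Aix]; exists i => //; case: (hFU i) => _ _ _ + _; apply.
- apply: (@le_trans _ _ (qnorm_indic X (\bigcup_n S n))).
    apply: qnorm_indicS.
    + apply: measurableI => //; apply: measurableD => //; exact: bigcup_measurable.
    + exact: bigcup_measurable.
    (* A point of [U i] outside [G m] either lies in [F i], and belongs to the truncation error, or
       lies in [U i] outside [F i]. *)
    move=> x [Bx [[i _ Uix] Gx]]; have [Fix|Fix] := pselect (F i x).
      by exists 0%N => //; split => //; split => //; exists i.
    by exists i.+1.
  apply: qnorm_indic_bigcup => //; first exact: ltW.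
  by case=> [//|n] /=; case: (hFU n).
Qed.

Lemma qnorm_regular_borel (A : set P) : borel_set A -> qnorm_regular B A.
Proof.
apply: smallest_sub; last exact: qnorm_regular_open.
split.
- by apply: qnorm_regular_open; exact: open0.
- by move=> C rC; rewrite setTD; exact: qnorm_regularC.
- exact: qnorm_regular_bigcup.
Qed.

End fixed_window.
End regularity.

(** * Open supersets and lower semicontinuous majorants *)

Section lower_semicontinuous_approximation.
Context {d : measure_display} {R : realType} {P : measurableMetricType d R}
  {mu : {measure set P -> \bar R}} (X : quasiBanachLattice mu).
Hypothesis mu_regular : borel_regular mu.
Hypothesis mu_balls : balls_finite_positive mu.
Hypothesis bounded_abs_cont : forall B : set P, measurable B -> metric_bounded B ->
  absolutely_continuous_qnorm X (fun x => (\1_B x)%:E).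

(** Borel regularity only equates the two measures; finiteness allows them to be subtracted. *)
Lemma borel_hull_null (A : set P) : measurable A -> mu A < +oo ->
  exists D, [/\ borel_set D, A `<=` D & mu (D `\` A) = 0].
Proof.
move=> mA Aoo; have [D [bD AD muD]] := mu_regular.2 A mA.
have mD := mu_regular.1 D bD.
have Doo : mu D < +oo by rewrite muD.
exists D; split=> //; transitivity (mu D - mu (D `&` A)); first exact: measureD.
by rewrite (setIidr AD) muD subee// ge0_fin_numE.
Qed.

Definition window (n : nat) : set P := ball (point : P) n.+1%:R.

Lemma window_measurable (n : nat) : measurable (window n).
Proof. by apply: (open_measurable_borel mu_regular); exact: open_mdist_ball. Qed.

Lemma window_bounded (n : nat) : metric_bounded (window n).
Proof.
exists (n.+1%:R + n.+1%:R)%R => x y.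
rewrite /window !ballEmdist/= => px py; apply: (le_trans (metric_triangle x point y)).
by rewrite lerD ?(ltW py)// metric_sym ltW.
Qed.

Lemma window_cover : \bigcup_n window n = setT.
Proof.
rewrite -subTset => x _; exists (Num.bound (mdist (point : P) x)) => //.
by rewrite /window ballEmdist/= (lt_trans (archi_boundP _))// ?ltr_nat// mdist_ge0.
Qed.

(** Absolute continuity is available on bounded sets only, so [A] is cut by balls exhausting the
    space. Each piece gets its own open set, cut by the same open ball, and the summable errors are
    added up over the union. *)
Lemma qnorm_outer_regular (A : set P) (e : R) : measurable A -> (0 < e)%R ->
  exists U, [/\ open U, A `<=` U & qnorm_indic X (U `\` A) <= e%:E].
Proof.
move=> mA e0.
have /choice[V hV] : forall n, exists V, [/\ open V, A `&` window n `<=` V &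
    qnorm_indic X ((V `&` window n) `\` A) <= (summable_error X e n)%:E].
  move=> n; have mW := window_measurable n.
  have mAW : measurable (A `&` window n) by exact: measurableI.
  have AWoo : mu (A `&` window n) < +oo.
    have /andP[_] := mu_balls (point : P) _ (ltr0Sn R n).
    by apply: le_lt_trans; apply: le_measure; rewrite ?inE//; exact: subIsetr.
  have [D [bD AD D0]] := borel_hull_null _ mAW AWoo.
  have [F [V [cF oV FD DV FV]]] := qnorm_regular_borel X mu_regular _ mW
    (bounded_abs_cont _ mW (window_bounded n)) _ bD _ (summable_error_gt0 X e n e0).
  have mF := closed_measurable_borel mu_regular _ cF.
  have mV := open_measurable_borel mu_regular _ oV.
  have mD := mu_regular.1 _ bD.
  exists V; split => //; first exact: subset_trans DV.
  apply: le_trans FV; apply: qnorm_indic_le.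
  - by apply: measurableD => //; exact: measurableI.
  - by apply: measurableI => //; exact: measurableD.
  (* A point of [V] outside [V] minus [F] lies in [F], hence in the hull [D]; if it is not in [A],
     it belongs to the null set by which [D] exceeds the piece of [A]. *)
  apply/eqP; rewrite -measure_le0 -D0; apply: le_measure; rewrite ?inE.
  - apply: measurableD; first by apply: measurableD => //; exact: measurableI.
    by apply: measurableI => //; exact: measurableD.
  - exact: measurableD.
  move=> x [[[Vx Wx] Ax] WVF]; split; last by move=> [].
  by apply: FD; apply: contrapT => Fx; apply: WVF.
exists (\bigcup_n (V n `&` window n)).
have oV n : open (V n) by case: (hV n).
have mV n : measurable (V n `&` window n).
  by apply: measurableI; [exact: (open_measurable_borel mu_regular)|exact: window_measurable].
split.
- by apply: bigcup_open => n _; apply: openI => //; exact: open_mdist_ball.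
- move=> x Ax; have [n _ Wx] : (\bigcup_n window n) x by rewrite window_cover.
  by exists n => //; split => //; case: (hV n) => _ + _; apply.
- rewrite setD_bigcupl; apply: qnorm_indic_bigcup; first exact: ltW.
  + by move=> n; exact: measurableD.
  + by move=> n; case: (hV n).
Qed.

(** The excess [w] is produced together with [v], since the difference of [v] and [u] is
    indeterminate where [u] is infinite. *)
Lemma lower_semicontinuous_approx (u : P -> \bar R) (e : R) :
  measurable_fun setT u -> (forall x, 0 <= u x) -> (0 < e)%R ->
  exists v w : P -> \bar R, [/\ lower_semicontinuous v, measurable_fun setT w,
    forall x, 0 <= w x, forall x, v x = u x + w x & qnorm X w <= e%:E].
Proof.
move=> mu_ u0 e0; pose A := greedy_set u.
have mA n : measurable (A n) by exact: measurable_greedy_set.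
have /choice[U hU] : forall n, exists U, [/\ open U, A n `<=` U &
    qnorm_indic X (U `\` A n) <= (summable_error X e n)%:E].
  by move=> n; apply: qnorm_outer_regular => //; exact: summable_error_gt0.
have oU n : open (U n) by case: (hU n).
have mUA n : measurable (U n `\` A n).
  by apply: measurableD => //; exact: (open_measurable_borel mu_regular).
have t0 (S : nat -> set P) n x : 0 <= (harmonic n)%:E * (\1_(S n) x)%:E :> \bar R.
  by rewrite mule_ge0// lee_fin// harmonic_ge0.
have mt n : measurable_fun setT
    (fun x => (harmonic n)%:E * (\1_(U n `\` A n) x)%:E : \bar R).
  apply: emeasurable_funM; first exact: measurable_cst.
  exact: measurable_EFin_indic.
exists (fun x => \sum_(0 <= n <oo) (harmonic n)%:E * (\1_(U n) x)%:E).
exists (fun x => \sum_(0 <= n <oo) (harmonic n)%:E * (\1_(U n `\` A n) x)%:E).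
split.
- by apply: lower_semicontinuous_nneseries_indic => // n; exact: harmonic_ge0.
- by apply: ge0_emeasurable_sum => // n x _ _; exact: (t0 (fun n => U n `\` A n)).
- by move=> x; apply: nneseries_ge0 => n _ _; exact: (t0 (fun n => U n `\` A n)).
- move=> x; rewrite [u x]greedy_sum_exhausts// -nneseriesD.
  + apply: eq_eseriesr => n _; rewrite -ge0_muleDr ?lee_fin//; congr (_ * _).
    rewrite -EFinD; congr EFin; rewrite !indicE in_setD.
    case: (boolP (x \in greedy_set u n)) => [|_]; last by rewrite add0r andbT.
    rewrite inE => Anx; rewrite mem_set ?addr0//.
    by case: (hU n) => _ + _; apply.
  + by move=> n _ _; exact: t0.
  + by move=> n _ _; exact: (t0 (fun n => U n `\` A n)).
- apply: qnorm_nneseries_le => //; first exact: ltW.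
    by move=> n x; exact: (t0 (fun n => U n `\` A n)).
  move=> n; rewrite qnormZ; last exact: measurable_EFin_indic.
  case: (hU n) => _ _; apply: le_trans.
  rewrite -[leRHS]mul1e; apply: lee_wpmul2r.
    by apply: qnorm_ge0; exact: measurable_EFin_indic.
  rewrite lee_fin ger0_norm ?harmonic_ge0//= invf_le1// ?ltr0n//.
  by rewrite ler1n.
Qed.

End lower_semicontinuous_approximation.

(** * The quasi-norm as an infimum over lower semicontinuous majorants *)

Theorem proposition2p1 (d : measure_display) (R : realType)
    (P : measurableMetricType d R) (mu : {measure set P -> \bar R})
    (mu_sigma_finite : sigma_finite [set: P] mu)
    (mu_borel_regular : borel_regular mu)
    (mu_balls : balls_finite_positive mu)
    (X : quasiBanachLattice mu)
    (bounded_abs_cont : forall B : set P, measurable B -> metric_bounded B ->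
      lattice_space X (fun x => (\1_B x)%:E) /\
      absolutely_continuous_qnorm X (fun x => (\1_B x)%:E))
    (u : P -> \bar R) (u_measurable : measurable_fun [set: P] u) :
  qnorm X u =
  ereal_inf [set qnorm X v | v in
    [set v : P -> \bar R | (forall x, `|u x| <= v x) /\ lower_semicontinuous v]].
Proof.
have lscm (v : P -> \bar R) : lower_semicontinuous v -> measurable_fun setT v.
  move=> /lower_semicontinuousP lv.
  apply: (measurability _ (ErealGenOInfty.measurableE R)).
  move=> /= _ [_ [a ->]] <-; apply: measurableI => //.
  by rewrite preimage_itvoy; exact: (open_measurable_borel mu_borel_regular).
have mabs : measurable_fun setT (fun x => `|u x|) by exact: measurableT_comp.
have abs_u : qnorm X (fun x => `|u x|) = qnorm X u.
  by apply/eqP; rewrite eq_le !qnorm_lattice//; apply: aeW => x; rewrite abse_id.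
apply/eqP; rewrite eq_le; apply/andP; split.
  (* Every majorant has at least the quasi-norm of [u], by the lattice property. *)
  apply: le_ereal_inf_tmp => _ [v [uv lv] <-].
  apply: qnorm_lattice => //; first exact: lscm.
  by apply: aeW => x; apply: (le_trans (uv x)); exact: lee_abs.
have [->|uoo] := eqVneq (qnorm X u) +oo; first exact: leey.
rewrite -ltey in uoo.
have abs_cont B : measurable B -> metric_bounded B ->
    absolutely_continuous_qnorm X (fun x => (\1_B x)%:E).
  by move=> mB bB; have [] := bounded_abs_cont B mB bB.
have /choice[vw hvw] : forall n, exists p : (P -> \bar R) * (P -> \bar R),
    [/\ lower_semicontinuous p.1, measurable_fun setT p.2, forall x, 0 <= p.2 x,
      forall x, p.1 x = `|u x| + p.2 x & qnorm X p.2 <= (@harmonic R n)%:E].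
  move=> n; have [v [w ?]] := lower_semicontinuous_approx X mu_borel_regular mu_balls
    abs_cont _ _ mabs (fun x => abse_ge0 (u x)) (@harmonic_gt0 R n).
  by exists (v, w).
have mv n : measurable_fun setT (vw n).1 by apply: lscm; case: (hvw n).
have vE n : (vw n).1 = (fun x => `|u x| + (vw n).2 x).
  by apply/funext => x; case: (hvw n).
have vfin n : qnorm X (vw n).1 < +oo.
  case: (hvw n) => _ mw w0 _ we; rewrite vE.
  apply: (le_lt_trans (qnorm_triangle X mabs mw)).
  rewrite lte_mul_pinfty//.
    by rewrite lee_fin (le_trans _ (concavity_modulus_ge1 X)).
  by rewrite abs_u lte_add_pinfty// (le_lt_trans we)// ltry.
(* The triangle inequality alone would bound the infimum only up to the factor
   [concavity_modulus X]; continuity of the quasi-norm removes it. Since [u] is finite almost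
   everywhere, subtracting [|u|] from the n-th majorant leaves the excess, of quasi-norm at most
   1/(n+1). *)
have vcvg : qnorm X (vw n).1 @[n --> \oo] --> qnorm X (fun x => `|u x|).
  apply: qnorm_continuous => //; first by rewrite abs_u.
  apply: (@squeeze_cvge _ _ _ _ (cst 0) _ (EFin \o @harmonic R)); last first.
  - exact: cvge_harmonic.
  - exact: cvg_cst.
  apply: nearW => n; case: (hvw n) => _ mw w0 _ we.
  have mB : measurable_fun setT (fun x => (vw n).1 x - `|u x|).
    exact: emeasurable_funB.
  rewrite qnorm_ge0//=; apply: le_trans we; apply: qnorm_lattice => //.
  have := qnorm_finite_ae X _ u_measurable uoo; apply: filterS => x ux.
  by rewrite vE addeAC subee ?add0e// ge0_fin_numE.
rewrite -abs_u -(cvg_lim _ vcvg)//; apply: lime_ge; first by apply/cvg_ex; eexists; exact: vcvg.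
apply: nearW => n; apply: ereal_inf_lbound; exists (vw n).1 => //.
split; last by case: (hvw n).
by move=> x; rewrite vE leeDl//; case: (hvw n).
Qed.
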